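(* Let $g:\mathcal{W}\to\mathbb{R}$ be a regularizer function and $\lambda$ some coefficient, and let $\mathcal{A}$ be the regularized ERM algorithm, which on the sample $\mathcal{S}_n=(Z_1,\dots,Z_n)$, i.i.d. from $\mu$, outputs $W_{\mathsf{RERM}}=\arg\min_{w\in\mathcal{W}}\left\{\hat L(w,\mathcal{S}_n)+\frac{\lambda}{n}g(w)\right\}$. Assume that the learning tuple $(\mu,\ell,\mathcal{W},\mathcal{A})$ satisfies the expected $(\eta,c)$-central condition for some constants $\eta>0$ and $0<c\le1$, and that for some $B>0$, $|g(w_1)-g(w_2)|\le B$ for any $w_1$ and $w_2$ in $\mathcal{W}$. Then for all $\eta'\in(0,\eta]$, $$\mathbb{E}_{W}\left[\mathcal{R}(W_{\mathsf{RERM}})\right]\le \frac1c\,\mathbb{E}_{P_{W\mathcal{S}_n}}\left[\hat{\mathcal{R}}_{\mathrm{reg}}(W_{\mathsf{RERM}},\mathcal{S}_n)\right]+\frac{\lambda B}{cn}+\frac{1}{c\eta' n}\sum_{i=1}^n I(W_{\mathsf{RERM}};Z_i).$$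
   Context: Setting. $\mathcal{Z}$ is the instance space, $\mu$ a probability distribution on $\mathcal{Z}$, $\mathcal{W}$ the hypothesis space, $\ell:\mathcal{W}\times\mathcal{Z}\to\mathbb{R}$ a loss function. The sample $\mathcal{S}_n=(Z_1,\dots,Z_n)$ consists of $n$ i.i.d. draws from $\mu$. A (possibly randomised) algorithm $\mathcal{A}:\mathcal{Z}^n\to\mathcal{W}$ produces a hypothesis $W$ from $\mathcal{S}_n$ (here $W=W_{\mathsf{RERM}}$). The tuple $(\mu,\ell,\mathcal{W},\mathcal{A})$ is called a learning tuple. $P_{W\mathcal{S}_n}$ is the induced joint law of $(W,\mathcal{S}_n)$, $P_{WZ_i}$ the induced joint law of $(W,Z_i)$, and $P_W$ the induced marginal law of $W$. Under $P_W\otimes\mu$, $W\sim P_W$ and $Z\sim\mu$ are independent. $\mathbb{E}_W$ denotes expectation under $P_W$. Definitions. $\hat L(w,\mathcal{S}_n)=\frac1n\sum_{i=1}^n\ell(w,Z_i)$. $w^*=\arg\min_{w\in\mathcal{W}}\mathbb{E}_{Z\sim\mu}[\ell(w,Z)]$ is the optimal hypothesis; $r(w,z)=\ell(w,z)-\ell(w^*,z)$. Excess risk: $\mathcal{R}(w)=\mathbb{E}_{Z\sim\mu}[\ell(w,Z)]-\mathbb{E}_{Z\sim\mu}[\ell(w^*,Z)]$. Empirical excess risk: $\hat{\mathcal{R}}(w,\mathcal{S}_n)=\frac1n\sum_{i=1}^n r(w,Z_i)$. Regularized empirical excess risk: $\hat{\mathcal{R}}_{\mathrm{reg}}(w,\mathcal{S}_n)=\hat{\mathcal{R}}(w,\mathcal{S}_n)+\frac{\lambda}{n}\left(g(w)-g(w^*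 )\right)$. $I(W;Z_i)=D(P_{WZ_i}\,\|\,P_W\otimes\mu)$ is the mutual information (KL divergence, natural logarithm). Expected $(\eta,c)$-central condition (for constants $\eta>0$, $0<c\le1$): $$\log\mathbb{E}_{P_W\otimes\mu}\left[e^{-\eta(\ell(W,Z)-\ell(w^*,Z))}\right]\le -c\,\eta\,\mathbb{E}_{P_W\otimes\mu}\left[\ell(W,Z)-\ell(w^*,Z)\right].$$
   Formalization: The coefficient λ is assumed nonnegative; for λ < 0 the claim fails, e.g. for a one-point hypothesis space, where every term is zero except λB/(cn) < 0. *)

(* Defs.v *)
From HB Require Import structures.
From mathcomp Require Import all_boot all_order all_algebra.
From mathcomp Require Import all_classical all_reals all_analysis.
From mathcomp Require Import measurable_realfun.

Set Implicit Arguments.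
Unset Strict Implicit.
Unset Printing Implicit Defensive.

Import Order.TTheory GRing.Theory Num.Theory.
Import numFieldNormedType.Exports.

Local Open Scope classical_set_scope.
Local Open Scope ring_scope.
Local Open Scope ereal_scope.

Section iid_law.
Context (d : measure_display) (T : measurableType d) (R : realType).
Variable mu : probability T R.

Definition tcons (n : nat) (x : T * n.-tuple T) : n.+1.-tuple T :=
  [the n.+1.-tuple T of x.1 :: x.2].

Lemma measurable_tcons n : measurable_fun [set: T * n.-tuple T] (@tcons n).
Proof. exact: measurable_cons. Qed.

HB.instance Definition _ n :=
  isMeasurableFun.Build _ _ _ _ (@tcons n) (@measurable_tcons n).

(* The law mu^n of n independent draws from mu. *)
Fixpoint iid_law (n : nat) : probability (n.-tuple T) R :=
  match n return probability (n.-tuple T) R with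
  | 0 => dirac [tuple]
  | m.+1 => distribution (mu \x iid_law m) (@tcons m)
  end.

Lemma iid_law_box n (A : 'I_n -> set T) : (forall i, measurable (A i)) ->
  iid_law n [set s | forall i, A i (tnth s i)] = \prod_(i < n) mu (A i).
Proof.
elim: n A => [|n IH] A mA.
  by rewrite big_ord0 /= diracE mem_set//= => -[].
have mB : measurable [set s : n.-tuple T | forall i, A (lift ord0 i) (tnth s i)].
  rewrite [X in measurable X](_ : _ =
      \bigcap_(i in [set: 'I_n]) ((@tnth n T ^~ i) @^-1` A (lift ord0 i))).
    apply: fin_bigcap_measurable => // i _.
    by rewrite -[X in measurable X]setTI; exact: measurable_tnth.
  by apply/seteqP; split=> s /= h i; [move=> _|]; exact: h.
rewrite big_ord_recl /= -IH; last by move=> i; exact: mA.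
rewrite -(product_measure1E mu (iid_law n) (mA ord0) mB).
rewrite /distribution /pushforward /=; congr (_ _).
apply/seteqP; split=> [[x s] /= h|[x s] /= [h0 h] i].
  split; first exact: (h ord0).
  by move=> i; have := h (lift ord0 i); rewrite tnthS.
by case: (unliftP ord0 i) => [j ->|->//]; rewrite tnthS.
Qed.

End iid_law.

Section learning_laws.
Context (dZ dW : measure_display) (Z : measurableType dZ)
  (W : measurableType dW) (R : realType).
Variables (mu : probability Z R) (n : nat) (A : R.-pker n.-tuple Z ~> W).

(* P_{W S_n}: draw s from mu^n, then the hypothesis w from A s. *)
Definition joint_law (X : set (W * n.-tuple Z)) : \bar R :=
  \int[iid_law mu n]_s A s (ysection X s).

Let measurable_section (X : set (W * n.-tuple Z)) : measurable X ->
  measurable_fun [set: n.-tuple Z] (fun s => (A s (ysection X s) : \bar R)).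
Proof.
move=> mX.
have mX' : measurable [set x : n.-tuple Z * W | X (x.2, x.1)].
  rewrite -[X in measurable X]setTI.
  exact: (measurable_swap measurableT mX).
have -> : (fun s => (A s (ysection X s) : \bar R)) =
    kfcomp A (EFin \o \1_[set x : n.-tuple Z * W | X (x.2, x.1)]).
  rewrite kfcompkindic//; apply/funext => s; congr (A s _).
apply: measurable_kfcomp; last by move=> t; rewrite lee_fin.
by apply/measurable_EFinP; exact: measurable_indic.
Qed.

Let joint_law0 : joint_law set0 = 0.
Proof. by apply: integral0_eq => s _; rewrite ysection0 measure0. Qed.

Let joint_law_ge0 X : 0 <= joint_law X.
Proof. by apply: integral_ge0 => s _. Qed.

Let joint_law_additive : semi_sigma_additive joint_law.
Proof.
move=> F mF tF mUF.
have -> : joint_law (\bigcup_k F k) = \sum_(k <oo) joint_law (F k).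
  rewrite /joint_law -integral_nneseries//; last first.
    by move=> k; exact: measurable_section.
  apply: eq_integral => s _; rewrite ysection_bigcup.
  rewrite measure_bigcup//; last 2 first.
  - by move=> k _; exact: measurable_ysection.
  - exact: trivIset_ysection.
  by apply: eq_eseriesl => k; rewrite in_setT.
by apply: is_cvg_nneseries => k _ _; exact: joint_law_ge0.
Qed.

HB.instance Definition _ := isMeasure.Build _ _ _ joint_law
  joint_law0 joint_law_ge0 joint_law_additive.

Let joint_law_setT : joint_law [set: _] = 1.
Proof.
transitivity (\int[iid_law mu n]_s (cst 1 s : \bar R)).
  apply: eq_integral => s _; rewrite (_ : ysection _ s = setT) ?prob_kernel//.
  by apply/seteqP; split=> // w _; rewrite /ysection/= inE.
by rewrite integral_cst// mul1e; exact: probability_setT.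
Qed.

HB.instance Definition _ :=
  Measure_isProbability.Build _ _ _ joint_law joint_law_setT.

Definition W_of (x : W * n.-tuple Z) : W := x.1.

Definition WZ_of (i : 'I_n) (x : W * n.-tuple Z) : W * Z := (x.1, tnth x.2 i).

Lemma measurable_W_of : measurable_fun [set: W * n.-tuple Z] W_of.
Proof. exact: measurable_fst. Qed.

Lemma measurable_WZ_of i : measurable_fun [set: W * n.-tuple Z] (WZ_of i).
Proof.
apply: measurable_fun_pair => //.
exact: (measurableT_comp (measurable_tnth i)).
Qed.

HB.instance Definition _ :=
  isMeasurableFun.Build _ _ _ _ W_of measurable_W_of.

HB.instance Definition _ i :=
  isMeasurableFun.Build _ _ _ _ (WZ_of i) (measurable_WZ_of i).

Definition hypothesis_law : probability W R := distribution joint_law W_of.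

Definition pair_law (i : 'I_n) : probability (W * Z)%type R :=
  distribution joint_law (WZ_of i).

End learning_laws.

(* D(P || Q), equal to +oo when P is not absolutely continuous w.r.t. Q. *)
Definition KL (d : measure_display) (T : measurableType d) (R : realType)
    (P Q : probability T R) : \bar R :=
  if `[< P `<< Q >]
  then \int[P]_x lne (Radon_Nikodym (charge_of_finite_measure P) Q x)
  else +oo.

Section risks.
Context (dZ dW : measure_display) (Z : measurableType dZ)
  (W : measurableType dW) (R : realType).
Variables (mu : probability Z R) (ell : W -> Z -> R).

Definition mutual_info (n : nat) (A : R.-pker n.-tuple Z ~> W) (i : 'I_n) :
    \bar R :=
  KL (pair_law mu A i) (hypothesis_law mu A \x mu).

Definition risk (w : W) : \bar R := 'E_mu[ell w].

(* The minimal risk is required to be finite, so that the excess risk below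
   is meaningful; other hypotheses may have risk +oo. *)
Definition optimal_hypothesis (wstar : W) : Prop :=
  mu.-integrable [set: Z] (EFin \o ell wstar) /\
  forall w, risk wstar <= risk w.

Definition emp_loss (n : nat) (w : W) (s : n.-tuple Z) : R :=
  (n%:R^-1 * \sum_(i < n) ell w (tnth s i))%R.

Definition RERM_objective (g : W -> R) (lambda : R) (n : nat)
    (w : W) (s : n.-tuple Z) : R :=
  (emp_loss w s + lambda / n%:R * g w)%R.

(* The output of A minimizes the objective, almost surely with respect to the
   sample and to the randomness of A (which may break ties arbitrarily). *)
Definition is_RERM (g : W -> R) (lambda : R) (n : nat)
    (A : R.-pker n.-tuple Z ~> W) : Prop :=
  {ae joint_law mu A, forall x, forall w,
    (RERM_objective g lambda x.1 x.2 <= RERM_objective g lambda w x.2)%R}.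

Variable wstar : W.

Definition excess_loss (w : W) (z : Z) : R := (ell w z - ell wstar z)%R.

Definition excess_risk (w : W) : \bar R := risk w - risk wstar.

Definition emp_excess_risk (n : nat) (w : W) (s : n.-tuple Z) : R :=
  (n%:R^-1 * \sum_(i < n) excess_loss w (tnth s i))%R.

Definition reg_emp_excess_risk (g : W -> R) (lambda : R) (n : nat)
    (w : W) (s : n.-tuple Z) : R :=
  (emp_excess_risk w s + lambda / n%:R * (g w - g wstar))%R.

(* The expectation on the right is required to exist; lne is the extended
   logarithm, so an infinite exponential moment violates the condition. *)
Definition expected_central (n : nat) (A : R.-pker n.-tuple Z ~> W)
    (eta c : R) : Prop :=
  let P := hypothesis_law mu A \x mu in
  P.-integrable [set: W * Z] (fun x => (excess_loss x.1 x.2)%:E) /\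
  lne 'E_P[fun x => expR (- eta * (excess_loss x.1 x.2))%R] <=
    (- (c * eta))%:E * 'E_P[fun x => excess_loss x.1 x.2].

End risks.

(* Main.v *)
(** Put r = excess loss, Q = P_W ⊗ mu and m = E_Q[r]. The central condition
    says E_Q[exp(eta (c m - r))] <= 1, and convexity of exp turns this into
    E_Q[exp h] <= 1 for h = eta' (c m - r). The Donsker-Varadhan inequality
    bounds h pointwise by a P_{W Z_i}-integrable G_i with
    E[G_i] <= I(W; Z_i). Only the sum over i of r(W, Z_i) is known to be
    integrable, so the n pointwise bounds are added before integrating. *)

Require Import Defs.
From mathcomp Require Import all_boot all_order all_algebra.
From mathcomp Require Import all_classical all_reals all_analysis.
From mathcomp Require Import measurable_realfun.
From mathcomp Require Import ring lra.

Import Order.TTheory GRing.Theory Num.Theory.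
Import numFieldNormedType.Exports.

Local Open Scope classical_set_scope.
Local Open Scope ring_scope.
Local Open Scope ereal_scope.

(** Used with [t] equal to [eta' / eta], to carry an exponential moment bound from [eta] down to a
    smaller [eta']. *)
Lemma expR_convex01 (R : realType) (t u : R) : (0 <= t <= 1)%R ->
  (expR (t * u) <= 1 - t + t * expR u)%R.
Proof.
move=> /andP[t0 t1].
(* tangent to expR at [t * u], evaluated at 0 and at u *)
have h0 : (expR (t * u) * (1 - t * u) <= 1)%R.
  by rewrite -ler_pdivlMl ?expR_gt0// mulr1 -expRN expR_ge1Dx.
have hu : (expR (t * u) * (1 + (u - t * u)) <= expR u)%R.
  rewrite -ler_pdivlMl ?expR_gt0// [leRHS]mulrC -expRN -expRD.
  exact: expR_ge1Dx.
have -> : (expR (t * u) = (1 - t) * (expR (t * u) * (1 - t * u)) +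
    t * (expR (t * u) * (1 + (u - t * u))))%R by ring.
rewrite lerD//.
  by rewrite -[leRHS]mulr1 ler_wpM2l// subr_ge0.
by rewrite ler_wpM2l.
Qed.

(** * Variational bound for the Kullback-Leibler divergence *)

Section variational_KL.
Context (d : measure_display) (T : measurableType d) (R : realType).
Implicit Types P Q : probability T R.

Lemma measurable_lne_EFin (f : T -> R) : measurable_fun [set: T] f ->
  measurable_fun [set: T] (fun x => lne (f x)%:E).
Proof.
move=> mf; apply: measurable_fun_ifT => //=.
  exact: measurable_fun_ler.
by apply/measurable_EFinP; apply: measurableT_comp => //; exact: measurable_ln.
Qed.

Lemma null_dominates_ae P Q (A : T -> Prop) : P `<< Q ->
  {ae Q, forall x, A x} -> {ae P, forall x, A x}.
Proof.
move=> /null_content_dominatesP PQ [N [mN QN AN]]; exists N; split => //.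
exact: PQ.
Qed.

(* The density is replaced by 1 on its zero set, which is P-negligible. *)
Lemma KL_density P Q : KL P Q < +oo -> exists p : T -> R,
  [/\ measurable_fun [set: T] p, (forall x, (0 < p x)%R),
      KL P Q = \int[P]_x (ln (p x))%:E &
      forall f, measurable_fun [set: T] f -> (forall x, 0 <= f x) ->
        \int[P]_x f x <= \int[Q]_x (f x * (p x)%:E)].
Proof.
rewrite /KL; case: asboolP => [PQ _|_]; last by rewrite ltxx.
(* This version of the density is nonnegative and finite at every point; it is matched below, almost
   everywhere, with the version [Radon_Nikodym] that defines [KL]. *)
pose F := Radon_Nikodym_SigmaFinite.f P Q.
have intF : Q.-integrable [set: T] F.
  exact: Radon_Nikodym_SigmaFinite.f_integrable.
have F0 x : 0 <= F x by exact: Radon_Nikodym_SigmaFinite.f_ge0.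
have Ffin x : F x \is a fin_num by exact: Radon_Nikodym_SigmaFinite.f_fin_num.
have mF : measurable_fun [set: T] F by exact: measurable_int intF.
pose q x := fine (F x).
have qE x : F x = (q x)%:E by rewrite fineK.
have mq : measurable_fun [set: T] q by apply/measurable_EFinP/(eq_measurable_fun F).
have q0 x : (0 <= q x)%R by rewrite fine_ge0.
pose p x := if (q x <= 0)%R then 1%R else q x.
have mp : measurable_fun [set: T] p.
  by apply: measurable_fun_ifT => //=; exact: measurable_fun_ler.
have p0 x : (0 < p x)%R by rewrite /p; case: (leP (q x) 0%R) => // _; exact: ltr01.
have qp x : (q x <= p x)%R.
  by rewrite /p; case: (leP (q x) 0%R) => // h; rewrite (le_trans h)// ler01.
have cov f : measurable_fun [set: T] f -> (forall x, 0 <= f x) ->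
    \int[P]_x f x = \int[Q]_x (f x * (q x)%:E).
  move=> mf f0; rewrite -(Radon_Nikodym_SigmaFinite.change_of_variables PQ)//.
  by apply: eq_integral => x _; rewrite -qE.
(* The [P]-measure of the set where [q] vanishes is the [Q]-integral of [q] over that set, hence
   0. *)
have aeq : {ae P, forall x, (0 < q x)%R}.
  have mA : measurable [set x | (q x <= 0)%R].
    rewrite -[X in measurable X]setTI.
    exact: measurable_fun_le.
  exists [set x | (q x <= 0)%R]; split => //; last first.
    by move=> x /= /negP; rewrite -leNgt.
  rewrite -[in LHS](setIT [set x | _]) -integral_indic// cov//.
  - apply: integral0_eq => x _; rewrite indicE -EFinM.
    case: (boolP (x \in _)); last by rewrite mul0r.
    rewrite inE/= => qx; have -> : q x = 0%R by apply/eqP; rewrite eq_le qx q0.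
    by rewrite mulr0.
  - by apply/measurable_EFinP; exact: measurable_indic.
exists p; split => //.
  pose g := Radon_Nikodym (charge_of_finite_measure P) Q.
  have gE x : g x = (fine (g x))%:E by rewrite fineK// Radon_Nikodym_fin_num.
  have mg : measurable_fun [set: T] (fine \o g).
    apply/measurable_EFinP/(eq_measurable_fun g) => [x _|]; first exact: gE.
    by apply: (measurable_int Q); exact: Radon_Nikodym_integrable.
  apply: ae_eq_integral => //.
  - apply: (eq_measurable_fun (fun x => lne ((fine \o g) x)%:E)).
      by move=> x _ /=; rewrite -[RHS]/(lne (g x)) [in RHS]gE.
    exact: measurable_lne_EFin.
  - by apply/measurable_EFinP; exact: (measurableT_comp (@measurable_ln R)).
  (* The two versions agree [Q]-almost everywhere, and domination transfers this to [P]. *)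
  - have Fg : {ae P, forall x, [set: T] x -> F x = g x}.
      apply: (null_dominates_ae _ _ _ PQ).
      exact: (ae_eq_Radon_Nikodym_SigmaFinite PQ measurableT).
    apply: filterS2 aeq Fg => x qx /(_ I) Fgx _.
    by rewrite -/g -Fgx qE lne_EFin// /p leNgt qx.
(* With [q] this is an equality; replacing [q] by the larger [p] leaves an inequality. *)
move=> f mf f0; rewrite cov//; apply: ge0_le_integral => //.
- by move=> x _; rewrite mule_ge0// lee_fin.
- by apply: emeasurable_funM => //; exact/measurable_EFinP.
- by apply: emeasurable_funM => //; exact/measurable_EFinP.
- by move=> x _; rewrite lee_wpmul2l// lee_fin.
Qed.

(** The lower bound [g] makes the negative part of [f] integrable, so an integral below [+oo] forces
    the positive part to be integrable too. *)
Lemma integrable_ge (P : probability T R) (f g : T -> R) :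
  measurable_fun [set: T] f -> (forall x, (g x <= f x)%R) ->
  P.-integrable [set: T] (EFin \o g) -> \int[P]_x (f x)%:E < +oo ->
  P.-integrable [set: T] (EFin \o f).
Proof.
move=> mf gf intg flty.
have mEf : measurable_fun [set: T] (EFin \o f) by exact/measurable_EFinP.
have fneg_lty : \int[P]_x (EFin \o f)^\- x < +oo.
  apply: le_lt_trans (integrable_lty measurableT (integrable_funeneg measurableT intg)).
  apply: ge0_le_integral => //; first exact: measurable_funeneg.
    exact/measurable_funeneg/(measurable_int _ intg).
  move=> x _; apply: (@funeneg_le _ _ [set: T]); rewrite ?inE// => y _.
  by rewrite lee_fin.
have fneg_fin : \int[P]_x (EFin \o f)^\- x \is a fin_num.
  by rewrite ge0_fin_numE// integral_ge0.
apply/integrableP; split => //.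
have -> : \int[P]_x `|(EFin \o f) x| =
    \int[P]_x (EFin \o f)^\+ x + \int[P]_x (EFin \o f)^\- x.
  rewrite -ge0_integralD//; last 2 first.
  - exact: measurable_funepos.
  - exact: measurable_funeneg.
  by rewrite -fune_abse.
rewrite lte_add_pinfty//.
move: flty; rewrite integralE/= -/(EFin \o f).
by rewrite lteBlDr// addye//; case: (\int[P]_x _) fneg_fin.
Qed.

(* With p the density of P, take G = ln p + expR h / p - 1. *)
Lemma KL_variational P Q (h : T -> R) : measurable_fun [set: T] h ->
  \int[Q]_x (expR (h x))%:E <= 1 -> KL P Q < +oo ->
  exists G : T -> R, [/\ P.-integrable [set: T] (EFin \o G),
    (forall x, (h x <= G x)%R) & \int[P]_x (G x)%:E <= KL P Q].
Proof.
move=> mh Qh KLoo; have [p [mp p0 KLE cov]] := KL_density _ _ KLoo.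
have mlnp : measurable_fun [set: T] (fun x => ln (p x)).
  by apply: measurableT_comp => //; exact: measurable_ln.
(* [expR (k x - ln (p x))] is the quotient of [expR (k x)] by the density *)
have quotient k : measurable_fun [set: T] k ->
    \int[Q]_x (expR (k x))%:E <= 1 ->
    P.-integrable [set: T] (EFin \o (fun x => expR (k x - ln (p x)))) /\
    \int[P]_x (expR (k x - ln (p x)))%:E <= 1.
  move=> mk Qk.
  have mq : measurable_fun [set: T] (fun x => expR (k x - ln (p x))).
    apply: measurableT_comp; first exact: measurable_expR.
    exact: measurable_funB.
  have le1 : \int[P]_x (expR (k x - ln (p x)))%:E <= 1.
    apply: le_trans Qk.
    have -> : \int[Q]_x (expR (k x))%:E =
        \int[Q]_x ((expR (k x - ln (p x)))%:E * (p x)%:E).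
      apply: eq_integral => x _.
      by rewrite -EFinM expRB lnK ?posrE// divfK// gt_eqF.
    apply: cov; first exact/measurable_EFinP.
    by move=> x; rewrite lee_fin expR_ge0.
  split => //; apply/integrableP; split; first exact/measurable_EFinP.
  under eq_integral do rewrite gee0_abs ?lee_fin ?expR_ge0//.
  by apply: le_lt_trans le1 _; rewrite ltry.
(* The case [k = 0] gives integrability of [1 / p], needed for the lower bound on [ln p]. *)
have [int0 _] : P.-integrable [set: T] (EFin \o (fun x => expR (0 - ln (p x)))) /\
    \int[P]_x (expR (0 - ln (p x)))%:E <= 1.
  apply: (quotient (cst 0%R)) => //=.
  by rewrite expR0 integral_cst// mul1e; exact: probability_le1.
have [inth leh] := quotient _ mh Qh.
have int1 (c : R) : P.-integrable [set: T] (EFin \o cst c).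
  exact: finite_measure_integrable_cst.
(* Below, [ln p >= 1 - 1 / p], which is integrable; above, the integral of [ln p] is
   [KL P Q < +oo]. *)
have intlnp : P.-integrable [set: T] (EFin \o (fun x => ln (p x))).
  apply: (@integrable_ge _ _ (fun x => 1 - expR (0 - ln (p x)))%R) => //.
  - move=> x; rewrite lerBlDr -lerBlDl.
    by apply: le_trans (expR_ge1Dx _); rewrite sub0r.
  - exact: (integrableB measurableT (int1 1%R) int0).
  - by rewrite -KLE.
pose e x := expR (h x - ln (p x)).
have intG : P.-integrable [set: T] (EFin \o (fun x => ln (p x) + (e x - 1))%R).
  exact: (integrableD measurableT intlnp
    (integrableB measurableT inth (int1 1%R))).
exists (fun x => ln (p x) + (e x - 1))%R; split => //.
  move=> x; rewrite -lerBlDl lerBrDl; exact: expR_ge1Dx.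
(* The correction [e - 1] has nonpositive integral because [e] integrates to at most 1. *)
have -> : \int[P]_x (ln (p x) + (e x - 1))%:E =
    \int[P]_x (ln (p x))%:E + (\int[P]_x (e x)%:E - 1).
  transitivity (\int[P]_x (ln (p x))%:E + \int[P]_x ((e x - 1)%:E)).
    rewrite -integralD_EFin//.
    exact: (integrableB measurableT inth (int1 1%R)).
  congr (_ + _); transitivity (\int[P]_x ((e x)%:E - (cst 1%R x)%:E)) => //.
  rewrite integralB_EFin//; congr (_ - _).
  by rewrite /= integral_cst// mul1e; exact: probability_setT.
by rewrite KLE geeDl// sube_le0.
Qed.

(** Take [h = 0] in the variational bound: the resulting [G] is nonnegative, and so is its
    integral. *)
Lemma KL_ge0 P Q : 0 <= KL P Q.
Proof.
have [KLoo|] := ltP (KL P Q) +oo; last by apply: le_trans; rewrite leey.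
have [||G [_ G0]] := @KL_variational P Q (cst 0%R) _ _ KLoo => //.
  by rewrite /= expR0 integral_cst// mul1e; exact: probability_le1.
by apply: le_trans; apply: integral_ge0 => x _; rewrite lee_fin; exact: G0.
Qed.

End variational_KL.

(** * Excess risk and the central condition *)

Section excess_risk.
Context (dZ dW : measure_display) (Z : measurableType dZ)
  (W : measurableType dW) (R : realType).
Variables (mu : probability Z R) (ell : W -> Z -> R).
Hypothesis mell : measurable_fun [set: W * Z] (fun x : W * Z => ell x.1 x.2).
Variable wstar : W.

Let r (x : W * Z) : R := excess_loss ell wstar x.1 x.2.

Lemma measurable_excess_loss : measurable_fun [set: W * Z] r.
Proof.
apply: measurable_funB => //.
apply: (measurableT_comp (f := ell wstar)); last exact: measurable_snd.
exact: (measurable_fun_pair2 wstar mell).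
Qed.

(** Risks may be infinite, so [ell] is split into its positive and negative parts and Tonelli is
    applied to each. *)
Lemma measurable_excess_risk : measurable_fun [set: W] (excess_risk mu ell wstar).
Proof.
have mE : measurable_fun [set: W * Z] (fun x : W * Z => (ell x.1 x.2)%:E).
  exact/measurable_EFinP.
apply: emeasurable_funB; last exact: measurable_cst.
rewrite [X in measurable_fun _ X](_ : _ = (fun w =>
   fubini_F mu ((fun x : W * Z => (ell x.1 x.2)%:E)^\+) w
   - fubini_F mu ((fun x : W * Z => (ell x.1 x.2)%:E)^\-) w)).
  apply: emeasurable_funB; apply: measurable_fun_fubini_tonelli_F; rewrite ?funeposE//.
  - exact: measurable_funepos.
  - exact: measurable_funeneg.
apply/funext => w; rewrite /risk unlock integralE; congr (_ - _).
  by apply: eq_integral => z _; rewrite !funeposE.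
by apply: eq_integral => z _; rewrite !funenegE.
Qed.

(** By Fubini, for almost every [w] the section of [r] is integrable; adding [ell wstar] makes
    [ell w] integrable, so the difference of risks is the integral of the difference. *)
Lemma integral_excess_risk (nu : probability W R) :
    mu.-integrable [set: Z] (EFin \o ell wstar) ->
    (nu \x mu).-integrable [set: W * Z] (EFin \o r) ->
  \int[nu]_w excess_risk mu ell wstar w = \int[nu \x mu]_x (r x)%:E.
Proof.
move=> istar ir; rewrite -(integral12_prod_meas1 ir).
apply: ae_eq_integral => //.
- exact: measurable_excess_risk.
- exact: (measurable_fubini_F ir).
apply: filterS (ae_integrable1 ir) => w irw _.
have iw : mu.-integrable [set: Z] (EFin \o ell w).
  apply: eq_integrable (integrableD measurableT irw istar) => // z _ /=.
  by rewrite -EFinD /excess_loss subrK.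
by rewrite /excess_risk /risk unlock -integralB_EFin.
Qed.

(** The case [t = 1] is the exponentiated central condition; for other [t], convexity bounds the
    integral by [(1 - t) + t]. *)
Lemma central_expR_le1 (Q : probability (W * Z)%type R) (eta c t : R) :
    (0 <= t <= 1)%R ->
    Q.-integrable [set: W * Z] (EFin \o r) ->
    lne 'E_Q[fun x => expR (- eta * r x)] <= (- (c * eta))%:E * 'E_Q[r] ->
  \int[Q]_x (expR (t * (c * eta * fine 'E_Q[r] - eta * r x)))%:E <= 1.
Proof.
move=> t01 ir; have mr := measurable_excess_loss.
have mexp (f : W * Z -> R) : measurable_fun [set: W * Z] f ->
    measurable_fun [set: W * Z] (fun x => (expR (f x))%:E).
  by move=> mf; apply/measurable_EFinP; exact: measurableT_comp.
have mB b : measurable_fun [set: W * Z] (fun x => b - eta * r x)%R.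
  by apply: measurable_funB => //; exact: measurable_funM.
have fr : 'E_Q[r] \is a fin_num by rewrite unlock integrable_fin_num.
rewrite -(fineK fr) /=; set m := fine _ => H.
have E0 : 0 <= 'E_Q[fun x => expR (- eta * r x)%R].
  by apply: expectation_ge0 => x; exact: expR_ge0.
(* [expeR] inverts [lne] on all of [[0, +oo]], so no separate argument is needed for a zero or
   infinite moment. *)
have H' : \int[Q]_x (expR (- eta * r x))%:E <= (expR (- (c * eta) * m))%:E.
  rewrite -[X in _ <= X]/(expeR (- (c * eta) * m)%:E) EFinM.
  move: H; rewrite -lee_expeR lneK; last by rewrite in_itv/= E0 leey.
  by rewrite unlock.
have H1 : \int[Q]_x (expR (c * eta * m - eta * r x))%:E <= 1.
  have -> : \int[Q]_x (expR (c * eta * m - eta * r x))%:E =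
      \int[Q]_x ((expR (c * eta * m))%:E * (expR (- eta * r x))%:E).
    by apply: eq_integral => x _; rewrite -EFinM -expRD mulNr.
  rewrite ge0_integralZl//; last by apply: mexp; exact: measurable_funM.
  apply: (@le_trans _ _ ((expR (c * eta * m))%:E * (expR (- (c * eta) * m))%:E)).
    by rewrite lee_wpmul2l// lee_fin expR_ge0.
  by rewrite -EFinM -expRD mulNr addrN expR0.
have /andP[t0 t1] := t01.
apply: (@le_trans _ _
   (\int[Q]_x ((1 - t)%:E + t%:E * (expR (c * eta * m - eta * r x))%:E))).
  apply: ge0_le_integral => //.
  - by apply: mexp; exact: measurable_funM.
  - by apply: emeasurable_funD => //; apply: emeasurable_funM => //; exact: mexp.
  - by move=> x _; rewrite -EFinM -EFinD lee_fin expR_convex01.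
rewrite ge0_integralD//; last 3 first.
- by move=> x _; rewrite lee_fin subr_ge0.
- by move=> x _; rewrite mule_ge0// lee_fin expR_ge0.
- by apply: emeasurable_funM => //; exact: mexp.
rewrite ge0_integralZl//; last exact: mexp.
rewrite integral_cst//.
apply: (@le_trans _ _ ((1 - t)%:E * 1 + t%:E * 1)).
  apply: leeD; apply: lee_wpmul2l; rewrite ?lee_fin ?subr_ge0//.
  exact: probability_le1.
by rewrite !mule1 -EFinD subrK.
Qed.

End excess_risk.

(** * Excess risk bound for the regularized algorithm *)

Theorem lemma1 (R : realType) (dZ dW : measure_display)
    (Z : measurableType dZ) (W : measurableType dW)
    (mu : probability Z R) (ell : W -> Z -> R)
    (mell : measurable_fun [set: W * Z] (fun x : W * Z => ell x.1 x.2))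
    (wstar : W) (hwstar : optimal_hypothesis mu ell wstar)
    (n : nat) (n_gt0 : (0 < n)%N)
    (g : W -> R) (mg : measurable_fun [set: W] g)
    (lambda : R) (lambda_ge0 : (0 <= lambda)%R)
    (A : R.-pker n.-tuple Z ~> W) (hA : is_RERM mu ell g lambda A)
    (hint : (joint_law mu A).-integrable [set: W * n.-tuple Z]
       (fun x => (reg_emp_excess_risk ell wstar g lambda x.1 x.2)%:E))
    (eta c : R) (eta_gt0 : (0 < eta)%R) (c_gt0 : (0 < c)%R) (c_le1 : (c <= 1)%R)
    (hcentral : expected_central mu ell wstar A eta c)
    (B : R) (B_gt0 : (0 < B)%R)
    (hB : forall w1 w2 : W, (`|g w1 - g w2| <= B)%R)
    (eta' : R) (eta'_gt0 : (0 < eta')%R) (eta'_le : (eta' <= eta)%R) :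
  \int[hypothesis_law mu A]_w excess_risk mu ell wstar w <=
    (c^-1)%:E *
      'E_(joint_law mu A)[fun x => reg_emp_excess_risk ell wstar g lambda x.1 x.2]
    + (lambda * B / (c * n%:R))%:E
    + ((c * eta' * n%:R)^-1)%:E * \sum_(i < n) mutual_info mu A i.
Proof.
pose r (x : W * Z) := excess_loss ell wstar x.1 x.2.
pose J : probability _ R := joint_law mu A.
pose Q : probability (W * Z)%type R := hypothesis_law mu A \x mu.
pose S (x : W * n.-tuple Z) := reg_emp_excess_risk ell wstar g lambda x.1 x.2.
have mr : measurable_fun [set: W * Z] r by exact: measurable_excess_loss.
have [ir cen] := hcentral; have [istar _] := hwstar.
have n0 : (0 < n%:R :> R)%R by rewrite ltr0n.
have int_fin : \int[Q]_x (r x)%:E \is a fin_num by exact: integrable_fin_num.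
rewrite (integral_excess_risk _ _ _ _ _ _ _ mell _ _ istar ir) -/Q -/r.
have SE : 'E_J[S] \is a fin_num by rewrite unlock; exact: integrable_fin_num.
rewrite -/J -/S.
have I0 i : 0 <= mutual_info mu A i by exact: KL_ge0.
(* If the information sum is infinite, so is the right-hand side, its other terms being finite. *)
have [sumoo|] := ltP (\sum_(i < n) mutual_info mu A i) +oo; last first.
  rewrite leye_eq => /eqP ->; rewrite gt0_muley ?lte_fin ?invr_gt0 ?mulr_gt0//.
  rewrite addey ?leey//.
  by rewrite -(fineK SE) -EFinM -EFinD.
have Ioo i : mutual_info mu A i < +oo.
  apply: le_lt_trans sumoo.
  by rewrite (bigD1 i)//= leeDl// sume_ge0.
rewrite -(fineK int_fin); set m := fine _.
have hexp : \int[Q]_x (expR (eta' / eta * (c * eta * m - eta * r x)))%:E <= 1.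
  have -> : m = fine 'E_Q[r] by rewrite unlock.
  apply: (@central_expR_le1 _ _ Z W R ell mell wstar) => //.
  by rewrite ler_pdivrMr// mul1r eta'_le andbT divr_ge0// ltW.
have mh : measurable_fun [set: W * Z]
    (fun x => eta' / eta * (c * eta * m - eta * r x))%R.
  apply: measurable_funM => //; apply: measurable_funB => //.
  exact: measurable_funM.
have /choice[G HG] := fun i => @KL_variational _ _ _ (pair_law mu A i) Q _ mh hexp (Ioo i).
(* [pair_law mu A i] is the image of [J] under [WZ_of i], so every [G i] can be pulled back to the
   single space of [J]. *)
have iGJ i : J.-integrable [set: W * n.-tuple Z] (EFin \o (G i \o WZ_of i)).
  have [iG _ _] := HG i; have mG := measurable_int _ iG.
  apply/integrableP; split; first exact: measurableT_comp mG (measurable_WZ_of i).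
  have /integrableP[_] := iG; rewrite ge0_integral_pushforward//.
  exact: measurableT_comp.
have EG i : \int[J]_x (G i (WZ_of i x))%:E = \int[pair_law mu A i]_x (G i x)%:E.
  have [iG _ _] := HG i.
  rewrite (@integral_distribution _ _ _ _ _ J (WZ_of i) (EFin \o G i))//.
    exact: measurable_int iG.
  exact: iGJ.
(* Summing [h] over the pairs gives [n c eta' m] minus [eta' n] times the empirical excess risk.
   Writing that risk through [S] leaves a regularizer term of at least [- eta' lambda B], which is
   absorbed into [K]. *)
pose K := (n%:R * c * eta' * m - eta' * lambda * B)%R.
pose L x := (K - eta' * n%:R * S x)%R.
have SL x : (L x <= \sum_(i < n) G i (WZ_of i x))%R.
  apply: (@le_trans _ _
    (\sum_(i < n) (eta' / eta * (c * eta * m - eta * r (WZ_of i x))))%R).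
    have -> : (\sum_(i < n) (eta' / eta * (c * eta * m - eta * r (WZ_of i x))) =
        n%:R * c * eta' * m - eta' * n%:R * emp_excess_risk ell wstar x.1 x.2)%R.
      under eq_bigr do rewrite mulrBr.
      rewrite sumrB sumr_const card_ord -mulr_natl -mulr_sumr -mulr_sumr.
      rewrite /emp_excess_risk; set s := (\sum_(i < n) _)%R.
      by field; rewrite !gt_eqF.
    rewrite /L /K /S /reg_emp_excess_risk mulrDr.
    have : (- (eta' * lambda * B) <= eta' * lambda * (g x.1 - g wstar))%R.
      rewrite -mulrN; apply: ler_wpM2l; first by rewrite mulr_ge0// ltW.
      by have := hB x.1 wstar; rewrite ler_norml => /andP[].
    have -> : (eta' * n%:R * (lambda / n%:R * (g x.1 - g wstar)) =
      eta' * lambda * (g x.1 - g wstar))%R by field; rewrite gt_eqF.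
    lra.
  by apply: ler_sum => i _; have [_ hG _] := HG i; exact: hG.
(* [L] is affine in [S], so [hint] suffices and no single [r (WZ_of i x)] has to be integrable. *)
have iL : J.-integrable [set: W * n.-tuple Z] (EFin \o L).
  have iK : J.-integrable [set: W * n.-tuple Z] (EFin \o cst K).
    exact: finite_measure_integrable_cst.
  exact: (integrableB measurableT iK (integrableZl measurableT (eta' * n%:R)%R hint)).
have intL : \int[J]_x (L x)%:E = (K - eta' * n%:R * fine 'E_J[S])%:E.
  transitivity (\int[J]_x ((EFin \o cst K) x - (eta' * n%:R)%:E * (S x)%:E)) => //.
  rewrite integralB//; last 2 first.
  - exact: finite_measure_integrable_cst.
  - exact: integrableZl.
  rewrite integralZl// /= integral_cst//.
  rewrite [X in _ * X](_ : _ = 1); last exact: probability_setT.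
  have -> : \int[joint_law mu A]_x (S x)%:E = (fine 'E_J[S])%:E.
    by rewrite fineK// unlock.
  by rewrite mule1.
have key : (K - eta' * n%:R * fine 'E_J[S])%:E
    <= \sum_(i < n) mutual_info mu A i.
  rewrite -intL; apply: (@le_trans _ _ (\int[J]_x \sum_(i < n) (G i (WZ_of i x))%:E)).
    apply: le_integral => //.
    - by apply: integrable_sum => // i _; exact: iGJ.
    - by move=> x _; rewrite /= sumEFin lee_fin; exact: SL.
  rewrite integral_sum//; apply: lee_sum => i _.
  by rewrite EG; have [] := HG i.
(* The information sum is now a real number [k]; what remains is to solve [key] for [m], dividing by
   [n c eta']. *)
move: key sumoo; have : 0 <= \sum_(i < n) mutual_info mu A i by exact: sume_ge0.
rewrite -[X in _%:E * X + _ + _](fineK SE).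
case: (\sum_(i < n) _) => [k| |]// _ key _.
rewrite -!EFinM -!EFinD lee_fin.
move: key; rewrite lee_fin /K => key.
set s := fine _ in key *.
have -> : (c^-1 * s + lambda * B / (c * n%:R) + (c * eta' * n%:R)^-1 * k =
   (eta' * n%:R * s + eta' * lambda * B + k) / (n%:R * c * eta'))%R.
  by field; rewrite !gt_eqF.
rewrite ler_pdivlMr ?mulr_gt0//.
lra.
Qed.
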